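(* Let $f_0(x)=\log|\cos\pi x|$ on $\mathbb T$. Then $\alpha(0):=\inf_{\mu\in\mathcal M_T}\int f_0\,d\mu=-\log2$ and $\beta(0):=\sup_{\mu\in\mathcal M_T}\int f_0\,d\mu=0$. Moreover, the limit $$\lim_{n\to\infty}\frac1n\sum_{k=0}^{n-1}\log|\cos\pi2^kx|,$$ whenever it exists, takes only one of the three values $0$, $-\log2$, $-\infty$: it equals $0$ at $x=0$, it equals $-\infty$ at the dyadic rationals $x=\frac{2k+1}{2^m}$, and otherwise it can only be $-\log 2$, which is attained on a set of full Lebesgue measure.
   Context: $\mathbb T=\mathbb R/\mathbb Z$, $Tx=2x\bmod1$, $\mathcal M_T$ the set of $T$-invariant Borel probability measures; convention $\log0=-\infty$. *)

(* Defs.v *)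
From HB Require Import structures.
From mathcomp Require Import all_boot all_order all_algebra.
From mathcomp Require Import all_classical all_reals all_analysis.
Set Implicit Arguments. Unset Strict Implicit. Unset Printing Implicit Defensive.
Import Order.TTheory GRing.Theory Num.Theory.
Local Open Scope classical_set_scope.
Local Open Scope ring_scope.

(* The circle T = R/Z is identified with the fundamental domain [0,1). *)
Definition doubling {R : realType} (x : R) : R :=
  2 * x - (Num.floor (2 * x))%:~R.

Definition f0 {R : realType} (x : R) : \bar R :=
  if cos (pi * x) == 0 then -oo%E else (ln `|cos (pi * x)|)%:E.

(* T-invariant Borel probability measures on T = [0,1):
   Borel probability measures on R concentrated on [0,1) with
   P (T^-1 A) = P A for every Borel A. *)
Definition invariant_measures (R : realType) : set (probability R R) :=
  [set P : probability R R | P `[0%R, 1%R[%classic = 1%E /\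
           forall A : set R, measurable A -> P (doubling @^-1` A) = P A].

Definition birkhoff_avg {R : realType} (x : R) (n : nat) : \bar R :=
  ((n%:R)^-1%:E * \sum_(k < n) f0 (2 ^+ k * x))%E.

Definition dyadic {R : realType} (x : R) : Prop :=
  exists k m : nat, (0 < m)%N /\ (2 * k + 1 < 2 ^ m)%N /\
    x = (2 * k + 1)%:R / (2 ^ m)%:R.

(* Main.v *)
Require Import Defs.
From HB Require Import structures.
From mathcomp Require Import all_boot all_order all_algebra.
From mathcomp Require Import all_classical all_reals all_analysis.
From mathcomp Require Import measurable_realfun.
From mathcomp Require Import ring lra.
Import Order.TTheory GRing.Theory Num.Theory numFieldNormedType.Exports.
Local Open Scope classical_set_scope.
Local Open Scope ring_scope.

(** Everything rests on the duplication formula |sin 2y| = 2 |cos y| |sin y|,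
    which makes f0 + ln 2 a coboundary g(Tx) - g(x) with g = ln |sin (pi x)|.

    Along an orbit it telescopes: for x neither zero nor dyadic, the n-th Birkhoff
    average is - ln 2 + (1/n) (ln |sin (pi 2^n x)| - ln |sin (pi x)|). Since the
    distance from 2^n x to the integers doubles as long as it is small,
    |sin (pi 2^n x)| is infinitely often bounded below, so - ln 2 is the only
    possible limit. It is reached almost everywhere by Borel-Cantelli: the points
    of [0, 1) with |sin (pi 2^n x)| < d lie in a union of 2^n + 1 balls of radius
    2 d / 2^n, and d = exp (- n / (k + 1)) is summable in n.

    For an invariant measure g need not be integrable. Replacing |sin (pi x)| by
    its maximum with exp (- n) gives a bounded g_n, and ln 2 - g_n(Tx) + g_n(x) is
    nonnegative, has integral ln 2, and has a lower limit of at least - f0, so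
    Fatou's lemma yields the bound - ln 2. It is attained on the orbit
    {1/3, 2/3}; the supremum 0 is attained at the fixed point 0. *)

(** * Trigonometry of the doubling map *)

Lemma sin_pi_int {R : realType} (k : int) : sin (pi * k%:~R) = 0 :> R.
Proof.
have sin_nat n : sin (pi * n%:R) = 0 :> R.
  elim: n => [|n IH]; first by rewrite mulr0 sin0.
  by rewrite -addn1 natrD mulrDr sinD mulr1 IH sinpi mul0r mulr0 addr0.
by case: k => n; rewrite ?NegzE ?mulrNz ?mulrN ?sinN sin_nat ?oppr0.
Qed.

Lemma norm_cos_pi_int {R : realType} (k : int) : `|cos (pi * k%:~R)| = 1 :> R.
Proof. by apply: sin0cos1; exact: sin_pi_int. Qed.

Lemma norm_sin_pi_subz {R : realType} (x : R) (k : int) :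
  `|sin (pi * (x - k%:~R))| = `|sin (pi * x)|.
Proof. by rewrite mulrBr sinB sin_pi_int mulr0 subr0 normrM norm_cos_pi_int mulr1. Qed.

Lemma norm_cos_pi_subz {R : realType} (x : R) (k : int) :
  `|cos (pi * (x - k%:~R))| = `|cos (pi * x)|.
Proof. by rewrite mulrBr cosB sin_pi_int mulr0 addr0 normrM norm_cos_pi_int mulr1. Qed.

Lemma norm_sin_pi_double {R : realType} (x : R) :
  `|sin (pi * (2 * x))| = 2 * (`|cos (pi * x)| * `|sin (pi * x)|).
Proof.
have -> : pi * (2 * x) = (pi * x) *+ 2 by rewrite mulr2n; ring.
by rewrite sin_mulr2n -mulr_natl !normrM ger0_norm.
Qed.

Lemma norm_sin_pi_doubling {R : realType} (x : R) :
  `|sin (pi * doubling x)| = 2 * (`|cos (pi * x)| * `|sin (pi * x)|).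
Proof. by rewrite /doubling norm_sin_pi_subz norm_sin_pi_double. Qed.

(** The telescoping in multiplicative form: no division by the sine, so it also holds where the sine
    vanishes. *)
Lemma prod_norm_cos_pi {R : realType} (x : R) (n : nat) :
  2 ^+ n * `|sin (pi * x)| * \prod_(k < n) `|cos (pi * (2 ^+ k * x))| =
  `|sin (pi * (2 ^+ n * x))|.
Proof.
elim: n => [|n IH]; first by rewrite big_ord0 expr0 !mul1r mulr1.
rewrite big_ord_recr/= exprS -[2 * _ * x]mulrA norm_sin_pi_double -IH.
ring.
Qed.

(** Subtracting the floor moves the argument into [[0, pi]], where the cosine is injective and
    vanishes at [pi / 2]. *)
Lemma cos_pi_eq0 {R : realType} (x : R) : cos (pi * x) = 0 ->
  x = (Num.floor x)%:~R + 2^-1.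
Proof.
move=> cx0; set k := Num.floor x.
have /andP[kx xk] := floor_itv x.
have cu : cos (pi * (x - k%:~R)) = 0.
  by apply/eqP; rewrite -normr_eq0 norm_cos_pi_subz cx0 normr0.
have pi0 := pi_gt0 R.
suff: pi * (x - k%:~R) = pi / 2.
  by move=> /(mulfI (lt0r_neq0 pi0)) /(canRL (subrK _)); rewrite addrC.
have xk' : x < k%:~R + 1 by rewrite -[1]/(1%:~R) -intrD.
apply: cos_inj; last by rewrite cu cos_pihalf.
- rewrite in_itv/= mulr_ge0 ?subr_ge0 ?(ltW pi0)//= -[leRHS]mulr1 ler_pM2l//.
  by rewrite lerBlDr addrC ltW.
- by rewrite in_itv/= divr_ge0 ?(ltW pi0)//= ler_pdivrMr// ler_peMr ?(ltW pi0)// ler1n.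
Qed.

(** By the duplication formula, a first zero of the sine along the orbit comes from a zero of the
    cosine one step earlier. There [2 ^+ n * x = k + 1/2], so [x] would be dyadic with denominator
    [2 ^ n.+1]. *)
Lemma norm_sin_pi_nondyadic {R : realType} (x : R) (n : nat) :
  x \in `[0, 1[ -> x != 0 -> ~ dyadic x -> 0 < `|sin (pi * (2 ^+ n * x))|.
Proof.
rewrite in_itv/= => /andP[x0 x1] xn0 ndx; rewrite normr_gt0.
have xgt0 : 0 < x by rewrite lt_neqAle eq_sym xn0.
elim: n => [|n IH].
  rewrite expr0 mul1r gt_eqF// sin_gt0_pi// mulr_gt0 ?pi_gt0//=.
  by rewrite -[ltRHS]mulr1 ltr_pM2l ?pi_gt0.
rewrite exprS -mulrA -normr_eq0 norm_sin_pi_double mulf_neq0//.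
rewrite mulf_neq0 ?normr_eq0//; apply/eqP => /cos_pi_eq0.
have : 0 <= Num.floor (2 ^+ n * x) by rewrite floor_ge0 mulr_ge0// exprn_ge0.
case: (Num.floor _) => // k _ e; apply: ndx; exists k, n.+1.
have xE : x = (2 * k + 1)%:R / (2 ^ n.+1)%:R.
  rewrite natrX exprS invfM.
  have -> : (2 * k + 1)%:R * (2^-1 / 2 ^+ n) = (2 ^+ n * x) / 2 ^+ n :> R.
    by rewrite e mulrA natrD natrM mulrDl mulrAC divff// !mul1r.
  by rewrite mulrAC divff ?mul1r// expf_neq0.
split => //; split => //.
by move: x1; rewrite {1}xE ltr_pdivrMr ?ltr0n ?expn_gt0// mul1r ltr_nat.
Qed.

Lemma cos_pi_nondyadic {R : realType} (x : R) (n : nat) :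
  x \in `[0, 1[ -> x != 0 -> ~ dyadic x -> 0 < `|cos (pi * (2 ^+ n * x))|.
Proof.
move=> x01 x0 ndx; have := norm_sin_pi_nondyadic _ n.+1 x01 x0 ndx.
rewrite exprS -mulrA norm_sin_pi_double pmulr_rgt0// => h.
by rewrite lt_neqAle normr_ge0 andbT eq_sym; apply: contraTneq h => ->; rewrite mul0r ltxx.
Qed.

Lemma f0_fin {R : realType} (x : R) : 0 < `|cos (pi * x)| ->
  f0 x = (ln `|cos (pi * x)|)%:E.
Proof. by rewrite /f0 normr_gt0 => /negPf ->. Qed.

Lemma f0_le0 {R : realType} (x : R) : (f0 x <= 0)%E.
Proof. by rewrite /f0; case: ifP => // _; rewrite lee_fin ln_le0// cos_max. Qed.

Lemma birkhoff_avgE {R : realType} (x : R) (n : nat) :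
  x \in `[0, 1[ -> x != 0 -> ~ dyadic x ->
  birkhoff_avg x n = (n%:R^-1 *
    (ln `|sin (pi * (2 ^+ n * x))| - ln `|sin (pi * x)| - ln 2 *+ n))%:E.
Proof.
move=> x01 x0 ndx.
have c0 k := cos_pi_nondyadic _ k x01 x0 ndx.
have s0 := norm_sin_pi_nondyadic _ 0 x01 x0 ndx; rewrite expr0 mul1r in s0.
have p0 m : 0 < \prod_(k < m) `|cos (pi * (2 ^+ k * x))| by apply: prodr_gt0.
rewrite /birkhoff_avg (eq_bigr (fun k : 'I_n => (ln `|cos (pi * (2 ^+ k * x))|)%:E)); last first.
  by move=> k _; exact: f0_fin.
rewrite sumEFin -EFinM; congr (_ * _)%:E.
have -> : \sum_(k < n) ln `|cos (pi * (2 ^+ k * x))| =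
          ln (\prod_(k < n) `|cos (pi * (2 ^+ k * x))|).
  elim: n => [|n IH]; first by rewrite !big_ord0 ln1.
  by rewrite !big_ord_recr/= IH lnM ?posrE ?p0 ?c0.
have p2 : 0 < 2 ^+ n :> R by rewrite exprn_gt0.
rewrite -(prod_norm_cos_pi x n) !lnM ?posrE ?(mulr_gt0 p2)// lnXn//.
lra.
Qed.

(** * Pointwise limits of Birkhoff averages *)

Lemma birkhoff_avg0 {R : realType} (n : nat) : birkhoff_avg (0 : R) n = 0%E.
Proof.
rewrite /birkhoff_avg big1 ?mule0// => k _.
by rewrite /f0 !mulr0 cos0 oner_eq0 normr1 ln1.
Qed.

Lemma cos_pi_half_odd {R : realType} (k : nat) :
  cos (pi * (k%:R + 2^-1)) = 0 :> R.
Proof.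
by rewrite mulrDr cosD cos_pihalf mulr0 (sin_pi_int k%:Z) mul0r subr0.
Qed.

Lemma dyadic_half_odd {R : realType} (k m : nat) :
  2 ^+ m * ((2 * k + 1)%:R / (2 ^ m.+1)%:R) = k%:R + 2^-1 :> R.
Proof.
rewrite natrX exprS natrD natrM; field.
by rewrite expf_neq0.
Qed.

Lemma birkhoff_avg_dyadic {R : realType} (x : R) : dyadic x ->
  birkhoff_avg x @ \oo --> -oo%E.
Proof.
move=> [k [[|m] [m0 [_ xE]]]] => //.
apply: cvg_near_cst; near=> n.
have mn : (m < n)%N by near: n; exact: nbhs_infty_gt.
have fm : f0 (2 ^+ m * x) = -oo%E.
  by rewrite /f0 xE dyadic_half_odd cos_pi_half_odd eqxx.
(* The single infinite term, at index [m], absorbs the rest of the sum. *)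
rewrite /birkhoff_avg (bigD1 (Ordinal mn))//= fm addNye gt0_muleNy//.
by rewrite lte_fin invr_gt0 ltr0n (leq_trans _ mn).
Unshelve. all: end_near. Qed.

Lemma sin_pi_dyadic {R : realType} (x : R) : dyadic x ->
  \forall n \near \oo, sin (pi * (2 ^+ n * x)) = 0.
Proof.
move=> [k [[|m] [m0 [_ xE]]]]=> //; near=> n.
have mn : (m < n)%N by near: n; exact: nbhs_infty_gt.
have {mn} -> : n = ((n - m.+1) + m.+1)%N by rewrite subnK.
elim: (n - m.+1)%N => [|p IH]; apply/eqP; rewrite -normr_eq0.
  by rewrite add0n exprS -mulrA norm_sin_pi_double xE dyadic_half_odd
             cos_pi_half_odd normr0 mul0r mulr0.
by rewrite addSn exprS -mulrA norm_sin_pi_double IH normr0 !mulr0.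
Unshelve. all: end_near. Qed.

Lemma cvg_invn_mul_sub {R : realType} (a c : R) :
  (fun n : nat => n%:R^-1 * (a - c *+ n)) @ \oo --> - c.
Proof.
have inv0 : (fun n : nat => (n%:R : R)^-1) @ \oo --> (0 : R).
  apply/gtr0_cvgV0; last exact: cvgr_idn.
  by near=> n; rewrite ltr0n; near: n; exact: nbhs_infty_gt.
have : (fun n : nat => n%:R^-1 * a - c) @ \oo --> 0 * a - c.
  by apply: cvgB; [apply: cvgM => //; exact: cvg_cst | exact: cvg_cst].
rewrite mul0r sub0r; apply: cvg_trans; apply: near_eq_cvg; near=> n.
rewrite mulrBr -[c *+ n]mulr_natl mulKf// pnatr_eq0 -lt0n.
by near: n; exact: nbhs_infty_gt.
Unshelve. all: end_near. Qed.

(** Once [u] is known to converge, comparison along infinitely many indices is enough: if [l < c], a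
    real [r] strictly between them eventually separates [u] from [v]. *)
Lemma cvge_frequently_ge {R : realType} (u : nat -> \bar R) (v : nat -> R)
    (l : \bar R) (c : R) :
  u @ \oo --> l -> v @ \oo --> c ->
  (forall N, exists2 n, (N <= n)%N & ((v n)%:E <= u n)%E) -> (c%:E <= l)%E.
Proof.
move=> ul vc uv; rewrite leNgt; apply/negP => lc.
have [r lr rc] : exists2 r : R, (l < r%:E)%E & r < c.
  case: l lc {ul} => [l||]//.
  - by rewrite lte_fin => lc; exists ((l + c) / 2); rewrite ?lte_fin midf_lt.
  - by exists (c - 1); rewrite ?ltNyr// ltrBlDr ltrDl.
have nu : \forall n \near \oo, (u n < r%:E)%E
  by apply: (ul (fun y => (y < r%:E)%E)); exact: open_ereal_lt'.
have nv : \forall n \near \oo, r < v n by exact: (cvgr_gt _ vc).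
have [N _ H] : \forall n \near \oo, (u n < (v n)%:E)%E.
  by near=> n; apply: (@lt_trans _ _ r%:E); rewrite ?lte_fin; near: n.
have [n Nn] := uv N; rewrite leNgt => /negP; apply; exact: H.
Unshelve. all: end_near. Qed.

(* While [|sin (pi y)|] stays below [1/2] it does not decrease under doubling,
   because there [2 |cos (pi y)| >= 1]. *)
Lemma norm_sin_pi_frequently_ge {R : realType} (x : R) :
  (forall n, 0 < `|sin (pi * (2 ^+ n * x))|) ->
  exists2 m : R, 0 < m &
    forall N, exists2 n, (N <= n)%N & m <= `|sin (pi * (2 ^+ n * x))|.
Proof.
move=> s0; set s := fun n => `|sin (pi * (2 ^+ n * x))|.
(* Either the sines stay below 1/2 from some [N] on, hence never drop below [s N], or they reach 1/2
   infinitely often. *)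
have [[N sN]|big] := pselect (exists N, forall n, (N <= n)%N -> s n < 2^-1).
  have mono p : s N <= s (N + p)%N.
    elim: p => [|p IH]; first by rewrite addn0.
    apply: (le_trans IH); rewrite addnS /s exprS -[2 * _ * x]mulrA norm_sin_pi_double.
    rewrite [2 * (_ * `|sin _|)]mulrA ler_peMl//.
    have := sN (N + p)%N (leq_addr _ _); rewrite /s.
    set y := pi * _ => sy.
    have := cos2Dsin2 y; rewrite -[cos y ^+ 2]real_normK ?num_real//.
    rewrite -[sin y ^+ 2]real_normK ?num_real//.
    have := normr_ge0 (sin y); have := normr_ge0 (cos y).
    nra.
  exists (s N) => [|M]; [exact: s0|exists (maxn N M); first exact: leq_maxr].
  by have := mono (maxn N M - N)%N; rewrite subnKC// leq_maxl.
exists 2^-1; first by rewrite invr_gt0.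
move=> N; apply: contrapT => no; apply: big; exists N => n Nn.
by rewrite ltNge; apply/negP => h; apply: no; exists n.
Qed.

Lemma cvg_seq_EFin {R : realType} (u : nat -> R) (a : R) :
  u @ \oo --> a -> (fun n => (u n)%:E) @ \oo --> a%:E.
Proof. by move=> ua; apply: cvg_EFin => //; exact: nearW. Qed.

(** The upper bound drops the nonpositive term [ln |sin (pi 2^n x)|] at every [n]. The lower bound
    replaces it by the constant [ln m] at infinitely many [n]. *)
Lemma birkhoff_avg_lim_nondyadic {R : realType} (x : R) (l : \bar R) :
  x \in `[0, 1[ -> x != 0 -> ~ dyadic x ->
  birkhoff_avg x @ \oo --> l -> l = (- ln 2)%:E.
Proof.
move=> x01 x0 ndx cl; apply/eqP; rewrite eq_le; apply/andP; split.
  have := cvg_invn_mul_sub (- ln `|sin (pi * x)|) (ln 2) => /(cvg_seq_EFin _ _) H.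
  apply: (lee_cvg_to cl H); apply: nearW => n /=.
  rewrite birkhoff_avgE// lee_fin ler_wpM2l// lerB// gerDr.
  by rewrite ln_le0// sin_max.
have s0 n := norm_sin_pi_nondyadic x n x01 x0 ndx.
have [m m0 freq] := norm_sin_pi_frequently_ge x s0.
apply: (cvge_frequently_ge _ _ _ _ cl (cvg_invn_mul_sub (ln m - ln `|sin (pi * x)|) (ln 2))).
move=> N; have [n Nn mn] := freq N; exists n => //.
by rewrite birkhoff_avgE// lee_fin ler_wpM2l// lerB// lerB// ler_ln ?posrE.
Qed.

(** The hypothesis puts [(1/n) ln |sin (pi 2^n x)|] eventually in [[- 1/(k+1), 0]] for each [k].
    Using countably many rates suits a countable union of null sets. *)
Lemma birkhoff_avg_cvg {R : realType} (x : R) : x \in `[0, 1[ ->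
  (forall k, \forall n \near \oo,
    expR (- (n%:R / k.+1%:R)) <= `|sin (pi * (2 ^+ n * x))|) ->
  birkhoff_avg x @ \oo --> (- ln 2)%:E.
Proof.
move=> x01 H.
(* Rate [k = 0] already excludes zero and the dyadic points, where the sine is eventually 0. *)
have [N _ sN] : \forall n \near \oo, 0 < `|sin (pi * (2 ^+ n * x))|.
  by apply: filterS (H 0%N) => n; apply: lt_le_trans; exact: expR_gt0.
have x0 : x != 0.
  by apply: contraTneq (sN N (leqnn N)) => ->; rewrite !mulr0 sin0 normr0 ltxx.
have ndx : ~ dyadic x.
  move=> /(sin_pi_dyadic x) [M _ /(_ _ (leq_maxl M N)) e].
  by have := sN _ (leq_maxr M N); rewrite /= e normr0 ltxx.
have s0 n := norm_sin_pi_nondyadic x n x01 x0 ndx.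
rewrite (_ : birkhoff_avg x = fun n => (n%:R^-1 * (- ln `|sin (pi * x)| - ln 2 *+ n) +
   n%:R^-1 * ln `|sin (pi * (2 ^+ n * x))|)%:E); last first.
  by apply/funext => n; rewrite birkhoff_avgE//; congr _%:E; ring.
apply: cvg_seq_EFin.
rewrite -[- ln 2]addr0; apply: cvgD; first exact: cvg_invn_mul_sub.
apply/cvgr0Pnorm_le => e e0.
have [k ke] : exists k : nat, k.+1%:R^-1 <= e.
  have [k _ /(_ k (leqnn k)) ke] := near_infty_natSinv_lt (PosNum e0).
  by exists k; exact: ltW.
near=> n.
have n0 : 0 < n%:R :> R by rewrite ltr0n; near: n; exact: nbhs_infty_gt.
have sn : expR (- (n%:R / k.+1%:R)) <= `|sin (pi * (2 ^+ n * x))| by near: n; exact: H.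
apply: le_trans ke.
rewrite ler0_norm; last first.
  by rewrite mulr_ge0_le0 ?invr_ge0 ?(ltW n0)// ln_le0// sin_max.
rewrite -mulrN mulrC ler_pdivrMr// lerNl mulrC -ler_expR lnK//.
by rewrite posrE.
Unshelve. all: end_near. Qed.

(** * Almost every point *)

(** If [cos t >= 1/4], the mean value theorem gives [sin t = t cos c] with [cos c > cos t].
    Otherwise the sine is close to 1, while [t / 4 <= 1/2] because [pi / 2 <= 2]. *)
Lemma sin_ge_quarter {R : realType} (t : R) : 0 <= t <= pi / 2 -> t / 4 <= sin t.
Proof.
move=> /andP[t0 tpi].
have [/andP[_ pi2] _] := @pihalf_02_cos_pihalf R.
have pi0 := pi_gt0 R.
have s0 : 0 <= sin t by apply: sin_ge0_pi; rewrite t0/=; lra.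
have [ct|ct] := lerP 4^-1 (cos t); last first.
  have c0 : 0 <= cos t by apply: cos_ge0_pihalf; rewrite tpi andbT; lra.
  have := cos2Dsin2 t; nra.
have [->|tn0] := eqVneq t 0; first by rewrite mul0r sin0.
have tgt0 : 0 < t by rewrite lt_neqAle eq_sym tn0.
have [c] := @MVT R sin cos 0 t tgt0 (fun x _ => is_derive_sin x)
  (continuous_subspaceT (@continuous_sin R)).
rewrite sin0 !subr0 in_itv/= => /andP[c0 ct'] ->.
have : cos t < cos c by rewrite ltr_cos// in_itv/=; apply/andP; split; lra.
nra.
Qed.

Lemma norm_sin_pi_ge {R : realType} (u : R) : `|u| <= 2^-1 ->
  `|u| / 2 <= `|sin (pi * u)|.
Proof.
move=> u2.
have -> : `|sin (pi * u)| = `|sin (pi * `|u|)|.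
  by case: (ger0P u) => // _; rewrite mulrN sinN normrN.
apply: le_trans (ler_norm _).
have pi2 := pi_ge2 R; have u0 := normr_ge0 u.
have : pi * `|u| / 4 <= sin (pi * `|u|) by apply: sin_ge_quarter; apply/andP; split; nra.
nra.
Qed.

(** If [|sin (pi y)| < d], then [y] is within [2 d] of an integer; dividing by [2 ^+ n] gives the
    radius. The index [2 ^ n] is included for the points near the right end of [[0, 1)]. *)
Definition dyadic_nbhd {R : realType} (d : R) (n : nat) : set R :=
  \big[setU/set0]_(j < (2 ^ n).+1) ball (j%:R / 2 ^+ n : R) (2 * d / 2 ^+ n).

Lemma measurable_dyadic_nbhd {R : realType} (d : R) (n : nat) :
  measurable (dyadic_nbhd d n).
Proof. by apply: bigsetU_measurable => j _; rewrite ball_itv; exact: measurable_itv. Qed.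

Lemma norm_sin_pi_dyadic_nbhd {R : realType} (d x : R) (n : nat) :
  x \in `[0, 1[ -> `|sin (pi * (2 ^+ n * x))| < d -> dyadic_nbhd d n x.
Proof.
rewrite in_itv/= => /andP[x0 x1] xd; set y := 2 ^+ n * x in xd.
have p2 : 0 < 2 ^+ n :> R by rewrite exprn_gt0.
have y0 : 0 <= y by rewrite mulr_ge0// ltW.
have yn : y < 2 ^+ n by rewrite -[ltRHS]mulr1 ltr_pM2l.
(* This floor is an integer nearest to [y], at distance at most 1/2. *)
have /andP[jy yj] := floor_itv (y + 2^-1).
have : 0 <= Num.floor (y + 2^-1) by rewrite floor_ge0 addr_ge0.
case: (Num.floor _) jy yj => // j jy yj _.
rewrite intrD/= in yj; rewrite -!pmulrn in jy yj.
have u2 : `|y - j%:R| <= 2^-1 by rewrite ler_norml; apply/andP; split; lra.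
have jn : (j < (2 ^ n).+1)%N.
  rewrite -(ltr_nat R) -natr1 natrX; lra.
rewrite /dyadic_nbhd.
rewrite -(bigcup_mkord _ (fun j : nat => ball (j%:R / 2 ^+ n : R) (2 * d / 2 ^+ n))).
exists j => //=.
rewrite /ball/= -(ltr_pM2r p2) mulfVK ?gt_eqF// -[X in _ * X](gtr0_norm p2) -normrM.
rewrite mulrBl mulfVK ?gt_eqF// [x * _]mulrC -/y distrC.
have := norm_sin_pi_ge _ u2; rewrite (norm_sin_pi_subz y j); lra.
Qed.

Lemma lebesgue_measure_dyadic_nbhd {R : realType} (d : R) (n : nat) : 0 <= d ->
  (lebesgue_measure (dyadic_nbhd d n) <= (8 * d)%:E)%E.
Proof.
move=> d0; have p2 : 0 < 2 ^+ n :> R by rewrite exprn_gt0.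
pose A (j : nat) : set R := ball (j%:R / 2 ^+ n : R) (2 * d / 2 ^+ n).
have mA j : (j < (2 ^ n).+1)%N -> measurable (A j).
  by move=> _; rewrite /A ball_itv; exact: measurable_itv.
apply: le_trans (Boole_inequality lebesgue_measure mA) _.
rewrite (eq_bigr (fun=> (2 * d / 2 ^+ n *+ 2)%:E)) => [|j _]; last first.
  by apply: lebesgue_measure_ball; rewrite divr_ge0 ?mulr_ge0// ltW.
rewrite sumEFin lee_fin sumr_const card_ord.
rewrite -[_ *+ (2 ^ n).+1]mulr_natl -[(2 ^ n).+1%:R]natr1 natrX.
(* There are [2 ^ n + 1] balls, each of length [4 d / 2 ^+ n]. *)
have -> : (2 ^+ n + 1) * (2 * d / 2 ^+ n *+ 2) = 4 * d + 4 * d / 2 ^+ n :> R.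
  by field; rewrite gt_eqF.
have : 4 * d / 2 ^+ n <= 4 * d.
  by rewrite ler_pdivrMr// ler_peMr ?mulr_ge0// exprn_ege1// ler1n.
lra.
Qed.

Lemma geometric_nneseries_lty {R : realType} (a z : R) : 0 <= z < 1 ->
  (\sum_(n <oo) (a * z ^+ n)%:E < +oo)%E.
Proof.
move=> /andP[z0 z1].
have -> : (\sum_(n <oo) (a * z ^+ n)%:E = (a * (1 - z)^-1)%:E)%E.
  apply/cvg_lim => //; under eq_fun do rewrite sumEFin.
  by apply: cvg_seq_EFin; apply: cvg_geometric_series; rewrite ger0_norm.
exact: ltry.
Qed.

Lemma negligible_birkhoff_avg {R : realType} :
  (@lebesgue_measure R).-negligible
    (`[0%R, 1%R[%classic `\` [set x | birkhoff_avg x @ \oo --> (- ln 2)%:E]).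
Proof.
pose B k n := dyadic_nbhd (expR (- (n%:R / k.+1%:R)) : R) n.
(* A point lying, for every [k], in only finitely many [B k n] satisfies the hypothesis of
   [birkhoff_avg_cvg]. *)
have sub : `[0, 1[%classic `\` [set x | birkhoff_avg x @ \oo --> (- ln 2)%:E]
    `<=` \bigcup_k lim_sup_set (B k).
  move=> x [x01 nx]; apply: contrapT => nB; apply: nx.
  apply: birkhoff_avg_cvg => // k.
  apply: contrapT => nk; apply: nB; exists k => // N _.
  apply: contrapT => nB; apply: nk; exists N => // n /= Nn.
  rewrite leNgt; apply/negP => sn; apply: nB; exists n => //.
  exact: norm_sin_pi_dyadic_nbhd.
apply: (@negligibleS _ _ _ (@lebesgue_measure R) _ _ sub).
apply: (@negligible_bigcup _ _ _ (@lebesgue_measure R)) => k.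
apply/(@negligibleP _ _ _ (@lebesgue_measure R)).
  apply: bigcap_measurable => // N _; apply: bigcup_measurable => n _.
  exact: measurable_dyadic_nbhd.
apply: (@lim_sup_set_cvg0 _ _ _ (@lebesgue_measure R)) => [n|]; first exact: measurable_dyadic_nbhd.
(* The measures are at most 8 times the powers of this ratio, so Borel-Cantelli applies. *)
have z01 : 0 <= expR (- (k.+1%:R)^-1 : R) < 1 by rewrite expR_ge0/= expR_lt1 oppr_lt0 invr_gt0.
apply: le_lt_trans (geometric_nneseries_lty 8 _ z01).
apply: lee_nneseries => n _ //.
by rewrite -expRM_natl mulrN; apply: lebesgue_measure_dyadic_nbhd; exact: expR_ge0.
Qed.

(** * Integrals against invariant measures *)

Lemma measurable_norm_sin_pi {R : realType} :
  measurable_fun [set: R] (fun x => `|sin (pi * x)|).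
Proof.
apply: measurableT_comp => //; apply: continuous_measurable_fun => x.
by apply: continuous_comp; [exact: mulrl_continuous | exact: continuous_sin].
Qed.

Lemma measurable_cos_pi {R : realType} :
  measurable_fun [set: R] (fun x => cos (pi * x)).
Proof.
apply: continuous_measurable_fun => x.
by apply: continuous_comp; [exact: mulrl_continuous | exact: continuous_cos].
Qed.

Lemma measurable_f0 {R : realType} : measurable_fun [set: R] (@f0 R).
Proof.
apply: measurable_fun_ifT => //.
  by apply: measurable_fun_eqr => //; exact: measurable_cos_pi.
apply/measurable_EFinP; apply: measurableT_comp => //.
by apply: measurableT_comp => //; exact: measurable_cos_pi.
Qed.

Lemma measurable_doubling {R : realType} : measurable_fun [set: R] (@doubling R).
Proof.
apply: measurable_funB; first exact: mulrl_measurable.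
apply: nondecreasing_measurable => // x y xy.
by rewrite ler_int; apply: le_floor; rewrite ler_pM2l.
Qed.

Lemma integral_cst_probability {R : realType} (P : probability R R) (D : set R)
    (r : \bar R) :
  measurable D -> P D = 1%E -> (\int[P]_(x in D) cst r x = r)%E.
Proof.
move=> mD PD; rewrite integral_cst//; transitivity (r * 1)%E; last exact: mule1.
by congr (_ * _)%E.
Qed.

(** Change of variables to the pushforward measure, which agrees with [P] by invariance.
    Nonnegativity replaces integrability. *)
Lemma ge0_integral_invariant {R : realType} (P : probability R R)
    (f : R -> \bar R) :
  invariant_measures P -> measurable_fun [set: R] f -> (forall x, 0 <= f x)%E ->
  (\int[P]_x f (doubling x) = \int[P]_x f x)%E.
Proof.
move=> [_ Pinv] mf f0.
have := ge0_integral_pushforward measurable_doubling P measurableT mf (fun x _ => f0 x).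
rewrite preimage_setT => <-.
by apply: eq_measure_integral => [|md A mA _]; [exact: measurable_doubling|exact: Pinv].
Qed.

(** This is [- g_n]; the sign makes it take values in [[0, n]], so that nonnegative integration
    applies. *)
Definition trunc_log_sin {R : realType} (n : nat) (x : R) : R :=
  - ln (Num.max `|sin (pi * x)| (expR (- n%:R))).

Definition trunc_cocycle {R : realType} (n : nat) (x : R) : R :=
  ln 2 + trunc_log_sin n (doubling x) - trunc_log_sin n x.

Lemma measurable_trunc_log_sin {R : realType} (n : nat) :
  measurable_fun [set: R] (trunc_log_sin n).
Proof.
apply: measurable_funN; apply: measurableT_comp => //.
by apply: measurable_maxr => //; exact: measurable_norm_sin_pi.
Qed.

Lemma measurable_trunc_cocycle {R : realType} (n : nat) :
  measurable_fun [set: R] (trunc_cocycle n).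
Proof.
apply: measurable_funB; last exact: measurable_trunc_log_sin.
apply: measurable_funD => //.
by apply: measurableT_comp; [exact: measurable_trunc_log_sin|exact: measurable_doubling].
Qed.

Lemma trunc_log_sin_bounds {R : realType} (n : nat) (x : R) :
  0 <= trunc_log_sin n x <= n%:R.
Proof.
rewrite /trunc_log_sin oppr_ge0 ln_le0/=; last first.
  by rewrite ge_max sin_max/= -expR0 ler_expR oppr_le0.
rewrite lerNl -[leLHS]expRK ler_ln ?posrE ?expR_gt0//.
by rewrite le_max lexx orbT.
Qed.

(** Doubling the point at most doubles [|sin (pi x)|], and truncating from below at a positive level
    preserves this bound. *)
Lemma trunc_cocycle_ge0 {R : realType} (n : nat) (x : R) : 0 <= trunc_cocycle n x.
Proof.
have e0 : 0 < expR (- n%:R : R) by exact: expR_gt0.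
rewrite /trunc_cocycle /trunc_log_sin opprK addrAC subr_ge0.
rewrite -lnM ?posrE ?lt_max ?e0 ?orbT// ler_ln ?posrE ?lt_max ?mulr_gt0 ?lt_max ?e0 ?orbT//.
rewrite norm_sin_pi_doubling ge_max; apply/andP; split.
  rewrite ler_pM2l//; apply: (@le_trans _ _ `|sin (pi * x)|).
    by rewrite ler_piMl// cos_max.
  by rewrite le_max lexx.
have : expR (- n%:R) <= Num.max `|sin (pi * x)| (expR (- n%:R)) by rewrite le_max lexx orbT.
lra.
Qed.

Lemma integral_trunc_cocycle {R : realType} (P : probability R R) (n : nat) :
  invariant_measures P -> (\int[P]_x (trunc_cocycle n x)%:E = (ln 2)%:E)%E.
Proof.
move=> Pinv; set g := fun x : R => (trunc_log_sin n x)%:E.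
have g0 x : (0 <= g x)%E by rewrite lee_fin; case/andP: (trunc_log_sin_bounds n x).
have mg : measurable_fun setT g.
  by apply/measurable_EFinP; exact: measurable_trunc_log_sin.
have ln2 : 0 <= ln 2 :> R by rewrite ln_ge0// ler1n.
have gfin : (\int[P]_x g x)%E \is a fin_num.
  rewrite ge0_fin_numE ?integral_ge0//.
  apply: (@le_lt_trans _ _ (\int[P]_x cst n%:R%:E x)%E).
    apply: ge0_le_integral => // x _.
    by rewrite lee_fin; case/andP: (trunc_log_sin_bounds n x).
  by rewrite integral_cst_probability ?probability_setT// ltry.
(* Moving [g] to the left leaves only nonnegative integrands; its integral is finite and cancels at
   the end. *)
have : (\int[P]_x ((trunc_cocycle n x)%:E + g x) =
        \int[P]_x (cst (ln 2)%:E x + g (doubling x)))%E.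
  by apply: eq_integral => x _; rewrite -!EFinD subrK.
rewrite ge0_integralD//; last 2 first.
- by move=> x _; rewrite lee_fin trunc_cocycle_ge0.
- by apply/measurable_EFinP; exact: measurable_trunc_cocycle.
rewrite ge0_integralD//; last by apply: measurableT_comp => //; exact: measurable_doubling.
rewrite ge0_integral_invariant// integral_cst_probability ?probability_setT//.
by move=> /(congr1 (fun z => z - \int[P]_x g x)%E); rewrite !addeK.
Qed.

(* The limit is [- f0 x] unless [sin (pi x) = 0], where it is [ln 2] while [f0 x = 0]. *)
Lemma limn_einf_trunc_cocycle {R : realType} (x : R) :
  (- f0 x <= limn_einf (fun n => (trunc_cocycle n x)%:E))%E.
Proof.
have lim1 (a l : \bar R) (u : nat -> \bar R) :
  u @ \oo --> l -> (a <= l)%E -> (a <= limn_einf u)%E.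
  by move=> /cvg_limn_einf_sup[-> _].
rewrite /trunc_cocycle /trunc_log_sin norm_sin_pi_doubling.
set s := `|sin (pi * x)|; set c := `|cos (pi * x)|.
have s_ge0 : 0 <= s by exact: normr_ge0.
have max0 n : Num.max 0 (expR (- n%:R)) = expR (- n%:R) :> R.
  by apply/max_idPr; exact: expR_ge0.
have maxs (t : R) : 0 < t -> \forall n \near \oo, Num.max t (expR (- n%:R)) = t.
  move=> t0; near=> n; apply/max_idPl.
  rewrite -[leRHS](@lnK _ t) ?posrE// ler_expR lerNl.
  by near: n; exact: nbhs_infty_ger.
have [s0|sn0] := eqVneq s 0.
  apply: (lim1 _ (ln 2)%:E).
    apply: cvg_near_cst; apply: nearW => n.
    by rewrite s0 !mulr0 max0 addrK.
  rewrite /f0 ifF; last by apply/negP; rewrite -norm_sin_eq1 -/s s0 eq_sym oner_eq0.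
  have c1 : c = 1 by apply: sin0cos1; apply/eqP; rewrite -normr_eq0 -/s s0.
  by rewrite -/c c1 ln1 oppe0 lee_fin ln_ge0// ler1n.
have sgt0 : 0 < s by rewrite lt_neqAle eq_sym sn0.
(* When the cosine vanishes, [- f0 x = +oo], and the terms [ln 2 + n] diverge accordingly. *)
have [c0|cn0] := eqVneq c 0.
  apply: (lim1 _ +oo%E); last exact: leey.
  have s1 : s = 1.
    by apply/eqP; rewrite norm_sin_eq1 -normr_eq0 -/c c0.
  apply/cvgeyPge => A; near=> n.
  have e1 : Num.max 1 (expR (- n%:R)) = 1 :> R by near: n; exact: maxs.
  rewrite c0 mul0r mulr0 max0 expRK s1 e1 ln1 !opprK addr0 lee_fin.
  apply: (@le_trans _ _ n%:R); first by near: n; exact: nbhs_infty_ger.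
  by rewrite lerDr ln_ge0// ler1n.
have cgt0 : 0 < c by rewrite lt_neqAle eq_sym cn0 normr_ge0.
apply: (lim1 _ (- ln c)%:E); last by rewrite f0_fin.
have cs : 0 < 2 * (c * s) by rewrite !mulr_gt0.
(* Both sines are positive here, so the truncation is eventually inactive and the sequence is
   constant. *)
apply: cvg_near_cst; near=> n.
have -> : Num.max s (expR (- n%:R)) = s by near: n; exact: maxs.
have -> : Num.max (2 * (c * s)) (expR (- n%:R)) = 2 * (c * s) by near: n; exact: maxs.
rewrite (@lnM _ 2) ?(@lnM _ c) ?posrE ?mulr_gt0//.
by congr (_%:E); ring.
Unshelve. all: end_near. Qed.

Lemma integral_f0E {R : realType} (P : probability R R) (D : set R) :
  (\int[P]_(x in D) f0 x = - \int[P]_(x in D) - f0 x)%E.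
Proof.
rewrite -integral_ge0N => [|x _]; last by rewrite oppe_ge0 f0_le0.
by apply: eq_integral => x _; rewrite oppeK.
Qed.

Lemma integral_f0_ge {R : realType} (P : probability R R) :
  invariant_measures P -> ((- ln 2)%:E <= \int[P]_(x in `[0%R, 1%R[%classic) f0 x)%E.
Proof.
move=> Pinv.
have mh n : measurable_fun [set: R] (fun x => (trunc_cocycle n x)%:E).
  by apply/measurable_EFinP; exact: measurable_trunc_cocycle.
have h0 n x : [set: R] x -> (0 <= (trunc_cocycle n x)%:E)%E.
  by rewrite lee_fin trunc_cocycle_ge0.
have mf : measurable_fun [set: R] (fun x => - f0 x)%E.
  by apply: measurableT_comp => //; exact: measurable_f0.
have f_ge0 (x : R) : (0 <= - f0 x)%E by rewrite oppe_ge0 f0_le0.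
have le2 : (\int[P]_x (- f0 x) <= (ln 2)%:E)%E.
  apply: (@le_trans _ _ (\int[P]_x limn_einf (fun n => (trunc_cocycle n x)%:E))%E).
    apply: ge0_le_integral => //; last by move=> x _; exact: limn_einf_trunc_cocycle.
    (* Measurability of the lower limit is deduced from that of an upper limit. *)
    rewrite (_ : (fun _ => _) = (fun x => - limn_esup (fun n => - (trunc_cocycle n x)%:E))%E).
      apply: measurableT_comp => //; apply: measurable_fun_limn_esup => n.
      exact: measurableT_comp.
    by apply/funext => x; rewrite -limn_einfN; congr limn_einf; apply/funext => n /=; rewrite opprK.
  apply: (le_trans (fatou P measurableT mh h0)).
  under eq_fun do rewrite integral_trunc_cocycle//.
  have /cvg_limn_einf_sup[-> //] : (fun=> (ln 2)%:E) @ \oo --> (ln 2 : R)%:E.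
  exact: cvg_cst.
rewrite integral_f0E EFinN leeN2; apply: le_trans le2.
(* Restricting the nonnegative [- f0] to [[0, 1)] can only lower its integral. *)
by apply: ge0_subset_integral => //; exact: measurable_itv.
Qed.

(** Evaluates the integral for both extremal measures: [f0] equals [c] almost everywhere and
    [[0, 1)] has mass 1. *)
Lemma integral_f0_concentrated {R : realType} (P : probability R R) (A : set R) (c : \bar R) :
  P `[0%R, 1%R[%classic = 1%E -> measurable A -> P A = 1%E ->
  (forall x, A x -> f0 x = c) -> (\int[P]_(x in `[0%R, 1%R[%classic) f0 x = c)%E.
Proof.
move=> P01 mA PA fA; rewrite -[RHS](integral_cst_probability P _ c _ P01)//.
apply: ae_eq_integral => //; first exact: measurable_funTS measurable_f0.
exists (~` A); split; first exact: measurableC.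
  by have := probability_setC P mA; rewrite PA subee.
by move=> x /= nfx Ax; apply: nfx => _; exact: fA.
Qed.

(** * Extremal measures: the fixed point and the orbit of period two *)

Lemma doubling0 {R : realType} : doubling (0 : R) = 0.
Proof. by rewrite /doubling mulr0 floor0 subr0. Qed.

Lemma doubling_third {R : realType} : doubling (3^-1 : R) = 2 / 3.
Proof.
rewrite /doubling (@floor_def _ _ 0) ?subr0//.
by rewrite add0r; apply/andP; split; lra.
Qed.

Lemma doubling_two_thirds {R : realType} : doubling (2 / 3 : R) = 3^-1.
Proof.
rewrite /doubling (@floor_def _ _ 1); first by lra.
by apply/andP; split; rewrite ?intrD/=; lra.
Qed.

(** Doubling swaps the two points, and they have the same [|sin|], being opposite modulo 1. The
    duplication formula reads [s = 2 |cos| s] at each, and [s > 0] cancels. *)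
Lemma norm_cos_pi_thirds {R : realType} :
  `|cos (pi * (3^-1 : R))| = 2^-1 /\ `|cos (pi * (2 / 3 : R))| = 2^-1.
Proof.
have s0 : 0 < `|sin (pi * (3^-1 : R))|.
  rewrite normr_gt0 gt_eqF// sin_gt0_pi//; have := pi_gt0 R => ?.
  by apply/andP; split; lra.
have s12 : `|sin (pi * (2 / 3 : R))| = `|sin (pi * (3^-1 : R))|.
  rewrite -(norm_sin_pi_subz _ 1) (_ : 2 / 3 - 1%:~R = - 3^-1 :> R); last by lra.
  by rewrite mulrN sinN normrN.
have := norm_sin_pi_doubling (3^-1 : R); have := norm_sin_pi_doubling (2 / 3 : R).
rewrite doubling_third doubling_two_thirds s12.
set s := `|sin _| in s0 *; move=> e1 e2.
by split; apply: (mulIf (lt0r_neq0 s0)); lra.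
Qed.

Lemma f0_half {R : realType} (x : R) : `|cos (pi * x)| = 2^-1 -> f0 x = (- ln 2)%:E.
Proof. by move=> c2; rewrite f0_fin c2 ?invr_gt0// lnV ?posrE. Qed.

Lemma dirac0_invariant {R : realType} : invariant_measures (dirac (0 : R) : probability R R).
Proof.
split; first by rewrite /= diracE mem_set//= in_itv/= lexx ltr01.
by move=> A mA; rewrite /= !diracE /preimage; congr ((_ : bool)%:R%:E);
  apply/idP/idP; rewrite !inE/= doubling0.
Qed.

(** The uniform measure on the orbit is built as the law of a fair coin under [X]. Doubling
    exchanges its two equal atoms, so invariance is commutativity of their sum. *)
Lemma exists_invariant_period2 {R : realType} : exists2 P : probability R R,
  invariant_measures P & P [set x | f0 x = (- ln 2)%:E] = 1%E.
Proof.
pose X (b : bool) : R := if b then 3^-1 else 2 / 3.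
have mX : measurable_fun [set: bool] X by [].
pose X' : {mfun bool >-> R} := HB.pack X (isMeasurableFun.Build _ _ _ _ _ mX).
have half01 : 0 <= (2^-1 : R) <= 1 by apply/andP; split; lra.
pose P : probability R R := distribution (bernoulli_prob (2^-1 : R)) X'.
have PE (A : set R) : P A = ((2^-1)%:E * (X true \in A)%:R%:E +
                             (2^-1)%:E * (X false \in A)%:R%:E)%E.
  rewrite /P /= /distribution /pushforward bernoulli_probE// !diracE.
  by rewrite /unstable.onem (_ : 1 - 2^-1 = 2^-1 :> R); last by lra.
have P1 (A : set R) : A 3^-1 -> A (2 / 3) -> P A = 1%E.
  by move=> A1 A2; rewrite PE !mem_set// !mule1 -EFinD; congr _%:E; lra.
have [c1 c2] := @norm_cos_pi_thirds R.
exists P; last by apply: P1; exact: f0_half.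
split; first by apply: P1; rewrite /= in_itv/=; apply/andP; split; lra.
move=> A mA.
have memE (x : R) : (x \in doubling @^-1` A) = (doubling x \in A).
  by apply/idP/idP; rewrite !inE.
by rewrite !PE !memE /X doubling_third doubling_two_thirds addeC.
Qed.

Theorem theorem5p1 (R : realType) :
  ereal_inf [set (\int[P]_(x in `[0%R, 1%R[%classic) f0 x)%E | P in @invariant_measures R]
    = (- ln 2)%:E /\
  ereal_sup [set (\int[P]_(x in `[0%R, 1%R[%classic) f0 x)%E | P in @invariant_measures R]
    = 0%E /\
  birkhoff_avg (0 : R) @ \oo --> 0%E /\
  (forall x : R, dyadic x -> birkhoff_avg x @ \oo --> -oo%E) /\
  (forall (x : R) (l : \bar R), x \in `[0, 1[ -> x != 0 -> ~ dyadic x ->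
     birkhoff_avg x @ \oo --> l -> l = (- ln 2)%:E) /\
  (@lebesgue_measure R).-negligible
     (`[0%R, 1%R[%classic `\` [set x | birkhoff_avg x @ \oo --> (- ln 2)%:E]).
Proof.
(* The level sets of [f0] serve as the sets of full mass for both extremal measures. *)
have mlevel (c : \bar R) : measurable [set x : R | f0 x = c].
  rewrite -[X in measurable X]setTI.
  by apply: (measurable_f0 _ [set c]) => //; exact: emeasurable_set1.
split.
  apply/eqP; rewrite eq_le; apply/andP; split; last first.
    by apply: le_ereal_inf_tmp => _ [P Pinv <-]; exact: integral_f0_ge.
  have [P Pinv P1] := @exists_invariant_period2 R.
  apply: ereal_inf_lbound; exists P => //.
  by apply: integral_f0_concentrated P1 _ => //; case: Pinv.
split.
  apply/eqP; rewrite eq_le; apply/andP; split.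
    apply: ge_ereal_sup => _ [P _ <-].
    rewrite integral_f0E oppe_le0; apply: integral_ge0 => x _.
    by rewrite oppe_ge0 f0_le0.
  apply: ereal_sup_ubound; exists (dirac (0 : R)); first exact: dirac0_invariant.
  apply: (@integral_f0_concentrated _ _ [set x | f0 x = 0%E]) => //.
  - by case: (@dirac0_invariant R).
  - by rewrite /= diracE mem_set//= /f0 mulr0 cos0 oner_eq0 normr1 ln1.
split; first by apply: cvg_near_cst; apply: nearW => n; exact: birkhoff_avg0.
split; first by move=> x; exact: birkhoff_avg_dyadic.
split; first by move=> x l; exact: birkhoff_avg_lim_nondyadic.
exact: negligible_birkhoff_avg.
Qed.
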